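(* With the notation of the context, let $x^*\in\Delta$ satisfy $F(x^* )=\inf_{x\in\Delta}F(x)$. Then $f_{r_1}(x^* )=f_{r_2}(x^* )$ for all $r_1,r_2\in\mathcal{F}$.
   Context: Fix an integer $n\ge2$ and free generators $\xi_1,\dots,\xi_n$ of a free group; throughout $i,j,k\in\{1,\dots,n\}$ and $t,s,p\in\{-1,+1\}$. Let $\Psi$ be the set of reduced words $\xi_i^{2t}$; $\xi_i^t\xi_j^{2s}$ ($i\ne j$); $\xi_i^t\xi_j^s\xi_k^p$ ($i\ne j$, $j\ne k$). For a letter $\xi_a^x$ let $S(\xi_a^x)\subset\Psi$ be the set of words in $\Psi$ beginning with $\xi_a^x$, namely $\{\xi_a^{2x}\}\cup\{\xi_a^x\xi_j^{2s}\}\cup\{\xi_a^x\xi_j^s\xi_k^p\}$; for $a\ne b$ let $S(\xi_a^x\xi_b^y)=\{\xi_a^x\xi_b^{2y}\}\cup\{\xi_a^x\xi_b^y\xi_k^p: k\ne b\}$. A relation $r$ is a pair $(\psi_r,\Psi_r)$ with $\psi_r\in\Psi$, $\Psi_r\subseteq\Psi$. Let $\mathcal{F}$ be the collection of the following relations (indices $i_0\ne j_0$, in type 5a $i_0,j_0,k_0$ pairwise distinct, all signs arbitrary): 1a: $\psi_r=\xi_{i_0}^{2t_0}$, $\Psi_r=\Psi\setminus S(\xi_{i_0}^{t_0})$; 2b: $\psi_r=\xi_{i_0}^{t_0}\xi_{j_0}^{2s_0}$, $\Psi_r=\Psi\setminus S(\xi_{i_0}^{t_0}\xi_{j_0}^{s_0})$;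 3a: $\psi_r=\xi_{i_0}^{t_0}\xi_{j_0}^{s_0}\xi_{i_0}^{t_0}$, $\Psi_r=\Psi\setminus S(\xi_{j_0}^{s_0}\xi_{i_0}^{t_0})$; 4b: $\psi_r=\xi_{i_0}^{t_0}\xi_{j_0}^{s_0}\xi_{i_0}^{-t_0}$, $\Psi_r=S(\xi_{i_0}^{t_0})$; 5a: $\psi_r=\xi_{i_0}^{t_0}\xi_{j_0}^{s_0}\xi_{k_0}^{p_0}$, $\Psi_r=\Psi\setminus S(\xi_{j_0}^{s_0}\xi_{k_0}^{p_0})$. Let $\Delta=\{x\in\mathbb{R}^\Psi: x(\psi)>0\ \forall\psi,\ \sum_{\psi}x(\psi)=1\}$. For a relation $r$ and $x\in\Delta$ put $x_r=x(\psi_r)$, $X_r=\sum_{\psi\in\Psi_r}x(\psi)$, $f_r(x)=\frac{1-x_r}{x_r}\cdot\frac{1-X_r}{X_r}$, and $F(x)=\max_{r\in\mathcal{F}}f_r(x)$. *)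

(* Defs.v *)
From HB Require Import structures.
From mathcomp Require Import all_boot all_order all_algebra.
From mathcomp Require Import reals.
Set Implicit Arguments. Unset Strict Implicit. Unset Printing Implicit Defensive.
Import Order.TTheory GRing.Theory Num.Theory.
Local Open Scope ring_scope.

(* A letter xi_i^t is a pair (i, t) with i : 'I_n and t : bool,
   where true encodes the exponent +1 and false encodes -1. *)
Definition letter (n : nat) := ('I_n * bool)%type.

(* Raw word shapes:
   inl (inl a)        ~  a a        (= xi_i^{2t})
   inl (inr (a, b))   ~  a b b      (= xi_i^t xi_j^{2s})
   inr (a, b, c)      ~  a b c      (= xi_i^t xi_j^s xi_k^p) *)
Definition raw (n : nat) :=
  ((letter n + letter n * letter n) + letter n * letter n * letter n)%type.

Definition w2 n (a : letter n) : raw n := inl (inl a).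
Definition w3 n (a b : letter n) : raw n := inl (inr (a, b)).
Definition w4 n (a b c : letter n) : raw n := inr (a, b, c).

Definition valid n (w : raw n) : bool :=
  match w with
  | inl (inl _) => true
  | inl (inr (a, b)) => a.1 != b.1
  | inr (a, b, c) => (a.1 != b.1) && (b.1 != c.1)
  end.

Definition Psi (n : nat) := {w : raw n | valid w}.

Definition letters n (w : raw n) : seq (letter n) :=
  match w with
  | inl (inl a) => [:: a; a]
  | inl (inr (a, b)) => [:: a; b; b]
  | inr (a, b, c) => [:: a; b; c]
  end.

Definition S1 n (a : letter n) : {set Psi n} :=
  [set w : Psi n | take 1 (letters (val w)) == [:: a]].

Definition S2 n (a b : letter n) : {set Psi n} :=
  [set w : Psi n | take 2 (letters (val w)) == [:: a; b]].

Definition relation n := (Psi n * {set Psi n})%type.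

Definition is1a n (r : relation n) : bool :=
  [exists i : 'I_n, exists t : bool,
     (val r.1 == w2 (i, t)) && (r.2 == ~: S1 (i, t))].

Definition is2b n (r : relation n) : bool :=
  [exists i : 'I_n, exists j : 'I_n, exists t : bool, exists s : bool,
     [&& i != j, val r.1 == w3 (i, t) (j, s) & r.2 == ~: S2 (i, t) (j, s)]].

Definition is3a n (r : relation n) : bool :=
  [exists i : 'I_n, exists j : 'I_n, exists t : bool, exists s : bool,
     [&& i != j, val r.1 == w4 (i, t) (j, s) (i, t) & r.2 == ~: S2 (j, s) (i, t)]].

Definition is4b n (r : relation n) : bool :=
  [exists i : 'I_n, exists j : 'I_n, exists t : bool, exists s : bool,
     [&& i != j, val r.1 == w4 (i, t) (j, s) (i, ~~ t) & r.2 == S1 (i, t)]].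

Definition is5a n (r : relation n) : bool :=
  [exists i : 'I_n, exists j : 'I_n, exists k : 'I_n,
   exists t : bool, exists s : bool, exists p : bool,
     [&& i != j, j != k, i != k, val r.1 == w4 (i, t) (j, s) (k, p)
       & r.2 == ~: S2 (j, s) (k, p)]].

Definition relF n : {set relation n} :=
  [set r | [|| is1a r, is2b r, is3a r, is4b r | is5a r]].

Definition inDelta (R : realType) n (x : Psi n -> R) : Prop :=
  (forall w, 0 < x w) /\ \sum_(w : Psi n) x w = 1.

Definition xr (R : realType) n (r : relation n) (x : Psi n -> R) : R := x r.1.
Definition Xr (R : realType) n (r : relation n) (x : Psi n -> R) : R :=
  \sum_(w in r.2) x w.

Definition f_r (R : realType) n (r : relation n) (x : Psi n -> R) : R :=
  (1 - xr r x) / xr r x * ((1 - Xr r x) / Xr r x).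

(* F(x) = max over relations in \mathcal{F} (all f_r are > 0 on Delta,
   and \mathcal{F} is nonempty, so the seed 0 is harmless). *)
Definition Fmax (R : realType) n (x : Psi n -> R) : R :=
  \big[Num.max/0]_(r in relF n) f_r r x.

(* Main.v *)
(* For F > 1 the sublevel set of f_r at level F is strictly convex in (x_r, X_r).
   There is a point x0, invariant under signed permutations of the generators, where all
   f_r take one common value F, and where positive Lagrange multipliers make a combination
   of the linearised constraints vanish identically on sum-zero vectors. A minimiser x* has
   f_r(x* ) <= F for every r, so each linearised constraint is nonnegative at x* - x0; as
   their positive combination is zero, each one is zero, and strict convexity forces
   x* = x0. *)
Require Import Defs.
From HB Require Import structures.
From mathcomp Require Import all_boot all_order all_algebra.
From mathcomp Require Import reals.
From mathcomp Require Import ring lra.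
Import Order.TTheory GRing.Theory Num.Theory.
Local Open Scope ring_scope.
Set Implicit Arguments. Unset Strict Implicit. Unset Printing Implicit Defensive.

(** * Tangent lines to the level curves of f_r *)

(* AM-GM, where [y * Y >= y0 * Y0] lies on the convex side of a hyperbola and
   the linear form is its tangent at [(y0, Y0)]. *)
Lemma tangent_hyperbola (R : realFieldType) (y Y y0 Y0 : R) :
  0 < y -> 0 < Y -> 0 < y0 -> 0 < Y0 -> y0 * Y0 <= y * Y ->
  0 <= Y0 * (y - y0) + y0 * (Y - Y0) /\
  (Y0 * (y - y0) + y0 * (Y - Y0) = 0 -> y = y0).
Proof.
move=> y_gt0 Y_gt0 y0_gt0 Y0_gt0 le_yY.
pose G := y0 * Y0; pose t := Y0 * y + y0 * Y.
have eq_t : Y0 * (y - y0) + y0 * (Y - Y0) = t - 2 * G by rewrite /t /G; ring.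
have G_gt0 : 0 < G by rewrite mulr_gt0.
have t_gt0 : 0 < t by rewrite addr_gt0 ?mulr_gt0.
have eq_sq : t ^+ 2 = (Y0 * y - y0 * Y) ^+ 2 + 4 * (G * (y * Y)).
  by rewrite /t /G; ring.
have le_G : G * G <= G * (y * Y) by rewrite ler_pM2l.
split.
  rewrite eq_t subr_ge0 -(@ler_pXn2r _ 2) ?nnegrE //; try exact: ltW.
  - by rewrite eq_sq; have := sqr_ge0 (Y0 * y - y0 * Y); lra.
  - by rewrite ltW // mulr_gt0.
rewrite eq_t => /eqP; rewrite subr_eq0 => /eqP t2G.
have /eqP : (Y0 * y - y0 * Y) ^+ 2 = 0.
  apply/eqP; rewrite eq_le sqr_ge0 andbT.
  have eq4 : (2 * G) ^+ 2 = 4 * (G * G) by ring.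
  by move: eq_sq; rewrite t2G eq4; lra.
rewrite sqrf_eq0 subr_eq0 => /eqP eq_yY.
(* The summands [Y0 * y] and [y0 * Y] of [t] now agree and add up to [2 * G], so each equals
   [y0 * Y0]. *)
have : 2 * (Y0 * y) = 2 * (Y0 * y0) by rewrite mulr2n !mulrDl !mul1r {2}eq_yY -/t t2G /G; ring.
by move/mulfI => /(_ _)/mulfI; apply; rewrite ?pnatr_eq0 ?gt_eqF.
Qed.

(* Multiplying [F x X >= (1 - x) (1 - X)] by [F - 1 > 0] turns it into
   [(1 + (F - 1) x) (1 + (F - 1) X) >= F]; [slope] is the ratio of the two partial
   derivatives at a point of the boundary. *)
Definition slope (R : realFieldType) (F x X : R) : R :=
  (1 + (F - 1) * x) / (1 + (F - 1) * X).

(** The factorised constraint is the one of [tangent_hyperbola] in the variables [1 + (F - 1) * x]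
    and [1 + (F - 1) * X]; its tangent form is the present one times the positive factor
    [(F - 1) * (1 + (F - 1) * X0)]. *)
Lemma tangent_level (R : realFieldType) (F x X x0 X0 : R) :
  1 < F -> 0 < x -> 0 < X -> 0 < x0 -> 0 < X0 ->
  (1 - x0) * (1 - X0) = F * x0 * X0 -> (1 - x) * (1 - X) <= F * x * X ->
  0 <= (x - x0) + slope F x0 X0 * (X - X0) /\
  ((x - x0) + slope F x0 X0 * (X - X0) = 0 -> x = x0).
Proof.
move=> F_gt1 x_gt0 X_gt0 x0_gt0 X0_gt0 eq0 le1.
have c_gt0 : 0 < F - 1 by rewrite subr_gt0.
have aff_gt0 z : 0 < z -> 0 < 1 + (F - 1) * z.
  by move=> z_gt0; rewrite addr_gt0 ?mulr_gt0.
have factor z Z : (1 + (F - 1) * z) * (1 + (F - 1) * Z) =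
    F + (F - 1) * (F * z * Z - (1 - z) * (1 - Z)) by ring.
have [] := @tangent_hyperbola R _ _ _ _ (aff_gt0 _ x_gt0) (aff_gt0 _ X_gt0)
  (aff_gt0 _ x0_gt0) (aff_gt0 _ X0_gt0).
  rewrite !factor eq0 subrr mulr0 addr0 lerDl mulr_ge0 ?subr_ge0 //; exact: ltW.
have Y_neq0 : 1 + (F - 1) * X0 != 0 by rewrite gt_eqF ?aff_gt0.
have -> : (1 + (F - 1) * X0) * (1 + (F - 1) * x - (1 + (F - 1) * x0)) +
     (1 + (F - 1) * x0) * (1 + (F - 1) * X - (1 + (F - 1) * X0)) =
   ((F - 1) * (1 + (F - 1) * X0)) * ((x - x0) + slope F x0 X0 * (X - X0)).
  by rewrite /slope; field.
have P_gt0 : 0 < (F - 1) * (1 + (F - 1) * X0) by rewrite mulr_gt0 ?aff_gt0.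
rewrite pmulr_rge0 // => ge0 eqx; split=> // e0.
move: eqx; rewrite e0 mulr0 => /(_ erefl) /addrI /mulfI; apply.
by rewrite gt_eqF.
Qed.

(** * Existence of the symmetric point *)

(* With [N = 2 n] letters, each followed by [M = 2 n - 2] letters, a symmetric point has
   weight [1 / N] on each [S1 a] and [s] on each [S2 a b]. Expressing [p], [q], [v] and [s]
   through [F], the equation [s = M q + v] is a polynomial equation in [F]. *)
Lemma symmetric_solution (R : rcfType) (N M : R) :
  4 <= N -> M = N - 2 ->
  exists F p q v s : R,
    [/\ 2 * M <= F, [/\ 0 < p, 0 < q, 0 < v & 0 < s <= 8^-1],
        s = M * q + v, N * (p + M * s) = 1 &
        [/\ (1 - p) * N^-1 = F * p * (1 - N^-1),
            (1 - q) * s = F * q * (1 - s) &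
            (1 - v) * (1 - N^-1) = F * v * N^-1]].
Proof.
move=> N_ge4 defM.
have M_ge2 : 2 <= M by lra.
have [N_gt0 M_gt0] : 0 < N /\ 0 < M by split; lra.
have NM_ge8 : 8 <= N * M by nra.
(* The level and sum equations give [p = 1 / D], [s = S / E], [v = (N - 1) / V] and [q = S / T]; [Q]
   is the numerator of [M * q + v - s] over [T * V * E]. *)
pose S F := (N - 1) * (F - 1); pose D F := 1 + F * (N - 1).
pose E F := N * M * D F; pose V F := N - 1 + F.
pose T F := S F + F * (E F - S F).
pose Q F := M * S F * V F * E F + (N - 1) * T F * E F - S F * V F * T F.
have pos F : 2 * M <= F ->
    [/\ 0 < S F, 0 < D F, 0 < V F, 8 * S F <= E F & 0 < T F].
  move=> F_ge.
  have F_ge4 : 4 <= F by lra.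
  have S_gt0 : 0 < S F by rewrite mulr_gt0; lra.
  have D_geS : S F <= D F by rewrite /S /D; nra.
  have D_gt0 : 0 < D F by lra.
  have E_ge : 8 * S F <= E F by rewrite /E; nra.
  by split=> //; rewrite ?/V ?/T; nra.
(* At [F = 2 * M] already [v >= 1/8 >= s]. This lower end of the interval and the bound [s <= 1/8]
   are what [slope_bound] later requires. *)
have Q_ge0 : 0 <= Q (2 * M).
  have [S_gt0 D_gt0 V_gt0 E_ge T_gt0] := pos _ (lexx _).
  have V_le : V (2 * M) <= 8 * (N - 1) by rewrite /V; lra.
  have le1 : S (2 * M) * V (2 * M) <= (N - 1) * E (2 * M).
    apply: (@le_trans _ _ (S (2 * M) * (8 * (N - 1)))).
      by rewrite ler_pM2l.
    have : (N - 1) * (8 * S (2 * M)) <= (N - 1) * E (2 * M) by rewrite ler_pM2l //; lra.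
    by lra.
  have E_gt0 : 0 < E (2 * M) by lra.
  have : 0 <= M * S (2 * M) * V (2 * M) * E (2 * M) 
    by apply: (mulr_ge0 (mulr_ge0 (mulr_ge0 _ _) _) _); exact: ltW.
  have : S (2 * M) * V (2 * M) * T (2 * M) <= (N - 1) * E (2 * M) * T (2 * M).
    by rewrite ler_pM2r.
  by rewrite /Q; lra.
(* Large enough that [M * q] and [v] are each at most [s / 2]; these are [half1] and [half2] with
   denominators cleared. *)
pose F1 := 4 * N ^+ 3.
have N2_ge : 16 <= N ^+ 2 by rewrite expr2; nra.
have F1_big : 16 * N * N <= F1 by rewrite /F1 exprSr expr2; nra.
have F1_ge : 2 * M <= F1 by nra.
have Q_le0 : Q F1 <= 0.
  have [S_gt0 D_gt0 V_gt0 E_ge T_gt0] := pos _ F1_ge.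
  have E_le : E F1 <= 2 * N * M * S F1.
    have : D F1 <= 2 * S F1 by rewrite /D /S; nra.
    by rewrite /E; nra.
  have half1 : 2 * (M * E F1) <= T F1.
    have : 4 * M * (7 / 8 * E F1) <= F1 * (E F1 - S F1).
      by apply: ler_pM; nra.
    by rewrite /T; nra.
  have half2 : 2 * ((N - 1) * E F1) <= S F1 * V F1.
    have V_ge : 4 * N * M * (N - 1) <= V F1.
      apply: (@le_trans _ _ F1); last by rewrite /V; lra.
      by rewrite /F1 exprSr expr2; nra.
    apply: (@le_trans _ _ (S F1 * (4 * N * M * (N - 1)))); last by rewrite ler_pM2l.
    have : (N - 1) * E F1 <= (N - 1) * (2 * N * M * S F1) by rewrite ler_pM2l //; lra.
    by lra.
  have SV_gt0 : 0 < S F1 * V F1 by rewrite mulr_gt0.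
  have : S F1 * V F1 * (2 * (M * E F1)) <= S F1 * V F1 * T F1 by rewrite ler_pM2l.
  have : 2 * ((N - 1) * E F1) * T F1 <= S F1 * V F1 * T F1 by rewrite ler_pM2r.
  by rewrite /Q; lra.
pose SP : {poly R} := (N - 1)%:P * ('X - 1%:P).
pose EP : {poly R} := (N * M)%:P * (1%:P + 'X * (N - 1)%:P).
pose VP : {poly R} := (N - 1)%:P + 'X.
pose TP : {poly R} := SP + 'X * (EP - SP).
pose QP : {poly R} := M%:P * SP * VP * EP + (N - 1)%:P * TP * EP - SP * VP * TP.
have QPE F : QP.[F] = Q F.
  by rewrite /QP /TP /VP /EP /SP !(hornerD, hornerN, hornerM, hornerC, hornerX).
have [F /andP[F_ge _]] : exists2 F, 2 * M <= F <= F1 & root (- QP) F.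
  by apply: poly_ivt => //; rewrite !hornerN !QPE oppr_le0 oppr_ge0 Q_ge0.
rewrite rootN rootE QPE => /eqP QF0.
have [S_gt0 D_gt0 V_gt0 E_ge T_gt0] := pos _ F_ge.
have E_gt0 : 0 < E F by lra.
have [N_neq0 M_neq0] : N != 0 /\ M != 0 by rewrite !gt_eqF.
have D_neq0 : D F != 0 by rewrite gt_eqF.
have V_neq0 : V F != 0 by rewrite gt_eqF.
have T_neq0 : T F != 0 by rewrite gt_eqF.
have E_neq0 : E F != 0 by rewrite gt_eqF.
exists F, (D F)^-1, (S F / T F), ((N - 1) / V F), (S F / E F).
split=> //.
- split; rewrite ?invr_gt0 ?divr_gt0 //; first by lra.
  by rewrite ler_pdivrMr //; lra.
- have -> : M * (S F / T F) + (N - 1) / V F =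
      S F / E F + Q F / (T F * V F * E F).
    by rewrite /Q; field; rewrite T_neq0 V_neq0 E_neq0.
  by rewrite QF0 mul0r addr0.
- have -> : N * ((D F)^-1 + M * (S F / E F)) = (N + S F) / D F.
    by rewrite /E; field; rewrite N_neq0 M_neq0 D_neq0.
  have -> : N + S F = D F by rewrite /S /D; ring.
  exact: divff.
- split.
  + by rewrite /D; field; rewrite N_neq0 -/(D F) D_neq0.
  + have -> : 1 - S F / T F = F * (E F - S F) / T F.
      by rewrite -[1](divff T_neq0) -mulrBl {1}/T addrAC subrr add0r.
    by field; rewrite T_neq0 E_neq0.
  + by rewrite /V; field; rewrite N_neq0 -/(V F) V_neq0.
Qed.

(** * Sums over words by prefix *)

(** [G] is defined on raw words, so that its values at [w2], [w3] and [w4] need no validity proof;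
    validity survives only as conditions on the indices of summation. *)
Lemma sum_Psi (V : nmodType) n (P : pred (raw n)) (G : raw n -> V) :
  \sum_(w : Psi n | P (val w)) G (val w) =
  \sum_(a | P (w2 a)) G (w2 a) +
  \sum_a \sum_(b | a.1 != b.1)
     ((if P (w3 a b) then G (w3 a b) else 0) +
      \sum_(c | (b.1 != c.1) && P (w4 a b c)) G (w4 a b c)).
Proof.
have -> : \sum_(w : Psi n | P (val w)) G (val w) = \sum_(w | valid w && P w) G w.
  rewrite (reindex_omap (val : Psi n -> raw n) insub) /=; last first.
    by move=> w /andP[vw _]; rewrite insubT.
  by apply: eq_bigl => w; rewrite valK eqxx andbT (valP w).
rewrite big_sumType /= big_sumType /= -addrA; congr (_ + _).
under [RHS]eq_bigr do rewrite big_split.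
rewrite big_split; congr (_ + _).
  under [RHS]eq_bigr do rewrite -big_mkcondr.
  by rewrite pair_big_dep; apply: eq_big => [[a b]|[a b] _].
rewrite pair_big_dep pair_big_dep.
by apply: eq_big => [[[a b] c]|[[a b] c] _] //=; rewrite andbA.
Qed.

Lemma sum_S1 (V : nmodType) n (G : raw n -> V) (a : letter n) :
  \sum_(w in S1 a) G (val w) =
  G (w2 a) + \sum_(b | a.1 != b.1)
     (G (w3 a b) + \sum_(c | b.1 != c.1) G (w4 a b c)).
Proof.
under eq_bigl do rewrite inE.
rewrite (sum_Psi (fun w => take 1 (letters w) == [:: a])) /=.
have eq1 (x : letter n) : ([:: x] == [:: a]) = (x == a) by rewrite eqseq_cons andbT.
congr (_ + _); first by under eq_bigl do rewrite eq1; rewrite big_pred1_eq.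
rewrite (bigD1 a) //= [X in _ + X]big1 => [|a' /negPf a'a].
  rewrite addr0; apply: eq_bigr => b _; rewrite eqxx; congr (_ + _).
  by apply: eq_bigl => c; rewrite andbT.
by apply: big1 => b _; rewrite eq1 a'a big_pred0 ?addr0 // => c; rewrite andbF.
Qed.

Lemma sum_S2 (V : nmodType) n (G : raw n -> V) (a b : letter n) : a.1 != b.1 ->
  \sum_(w in S2 a b) G (val w) =
  G (w3 a b) + \sum_(c | b.1 != c.1) G (w4 a b c).
Proof.
move=> ab; under eq_bigl do rewrite inE.
rewrite (sum_Psi (fun w => take 2 (letters w) == [:: a; b])) /=.
have eq2 (x y : letter n) : ([:: x; y] == [:: a; b]) = (x == a) && (y == b).
  by rewrite !eqseq_cons andbT.
rewrite big_pred0 ?add0r => [|x]; last first.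
  by rewrite eq2; apply/negP => /andP[/eqP-> /eqP ab1]; rewrite ab1 eqxx in ab.
rewrite (bigD1 a) //= [X in _ + X]big1 => [|a' /negPf a'a].
  rewrite addr0 (bigD1 b) //= [X in _ + X]big1 => [|b' /andP[_ /negPf b'b]].
    by rewrite addr0 eqxx; congr (_ + _); apply: eq_bigl => c; rewrite andbT.
  by rewrite eq2 b'b andbF big_pred0 ?addr0 // => c; rewrite !andbF.
by apply: big1 => b' _; rewrite eq2 a'a big_pred0 ?addr0 // => c; rewrite andbF.
Qed.

Lemma sum_Psi_S1 (V : nmodType) n (G : raw n -> V) :
  \sum_(w : Psi n) G (val w) = \sum_a \sum_(w in S1 a) G (val w).
Proof.
by rewrite (sum_Psi predT) -big_split; apply: eq_bigr => a _; rewrite sum_S1;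
  congr (_ + _); apply: eq_bigr => b _; congr (_ + _); apply: eq_bigl => c; rewrite andbT.
Qed.

(** * Indexing the relations by words *)

Definition inv_letter n (a : letter n) : letter n := (a.1, ~~ a.2).

Lemma inv_letterK n : involutive (@inv_letter n).
Proof. by case=> i t; rewrite /inv_letter negbK. Qed.

(* Each word of [Psi] is [psi_r] for exactly one relation [r] of [relF];
   [relset] is the corresponding [Psi_r]. *)
Definition relset n (w : raw n) : {set Psi n} :=
  match w with
  | inl (inl a) => ~: S1 a
  | inl (inr (a, b)) => ~: S2 a b
  | inr (a, b, c) => if c == inv_letter a then S1 a else ~: S2 b c
  end.

Lemma relF_relset n (r : relation n) : r \in relF n -> r.2 = relset (val r.1).
Proof.
rewrite inE => /or4P[|||/orP[]].
- by move=> /existsP[i /existsP[t /andP[/eqP-> /eqP->]]].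
- by move=> /existsP[i /existsP[j /existsP[t /existsP[s /and3P[_ /eqP-> /eqP->]]]]].
- move=> /existsP[i /existsP[j /existsP[t /existsP[s /and3P[_ /eqP-> /eqP->]]]]] /=.
  by rewrite xpair_eqE eqxx /=; case: t.
- move=> /existsP[i /existsP[j /existsP[t /existsP[s /and3P[_ /eqP-> /eqP->]]]]] /=.
  by rewrite eqxx.
move=> /existsP[i /existsP[j /existsP[k /existsP[t /existsP[s /existsP[p]]]]]].
by move=> /and5P[_ _ ik /eqP-> /eqP->] /=; rewrite xpair_eqE (eq_sym k i) (negPf ik).
Qed.

Lemma relset_relF n (w : Psi n) : (w, relset (val w)) \in relF n.
Proof.
rewrite inE; case: w => [[[[i t]|[[i t] [j s]]]|[[[i t] [j s]] [k p]]] /= vw].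
- apply/orP; left; apply/existsP; exists i; apply/existsP; exists t.
  by rewrite /= /w2 !eqxx.
- apply/orP; right; apply/orP; left.
  apply/existsP; exists i; apply/existsP; exists j.
  apply/existsP; exists t; apply/existsP; exists s.
  by rewrite /= /w3 (vw : i != j) !eqxx.
have /andP[ij jk] : (i != j) && (j != k) := vw.
do 2![apply/orP; right].
have [ik|ik] := eqVneq i k; last first.
  apply/orP; right; apply/orP; right.
  apply/existsP; exists i; apply/existsP; exists j; apply/existsP; exists k.
  apply/existsP; exists t; apply/existsP; exists s; apply/existsP; exists p.
  by rewrite ij jk ik /= /w4 eqxx xpair_eqE (eq_sym k i) (negPf ik) eqxx.
subst k; rewrite xpair_eqE eqxx /=.
have [->|pt] := eqVneq p (~~ t).
  apply/orP; right; apply/orP; left.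
  apply/existsP; exists i; apply/existsP; exists j.
  apply/existsP; exists t; apply/existsP; exists s.
  by rewrite ij /= /w4 !eqxx.
apply/orP; left.
apply/existsP; exists i; apply/existsP; exists j.
apply/existsP; exists t; apply/existsP; exists s.
have -> : p = t by move: pt; case: (p) (t) => [] [].
by rewrite ij /= /w4 !eqxx.
Qed.

(** * Symmetric weights and stationarity *)

Lemma sum_neq_const (R : pzRingType) n (i : 'I_n) (x : R) :
  \sum_(b : letter n | i != b.1) x = (2 * n%:R - 2) * x.
Proof.
rewrite (eq_bigl (fun b : letter n => (i != b.1) && predT b.2)); last first.
  by move=> b; rewrite andbT.
rewrite -(pair_big (fun j => i != j) predT (fun _ _ => x)) /=.
have -> : \sum_(t : bool) x = 2 * x.
  by rewrite big_bool mulr_natl mulr2n.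
have : \sum_(j < n) (2 * x) = n%:R * (2 * x).
  by rewrite sumr_const card_ord [RHS]mulr_natl.
rewrite (bigD1 i) //= => eqn.
under eq_bigl do rewrite eq_sym.
apply: (addrI (2 * x)); rewrite eqn mulrBl addrC subrK mulrA.
by rewrite -!natrM mulnC.
Qed.

(* [x] covers the types 2b, 3a and 5a at once: the symmetric point has equal weights there. *)
Definition profile (T : Type) (x2 x xi : T) n (w : raw n) : T :=
  match w with
  | inl (inl _) => x2
  | inl (inr _) => x
  | inr (a, b, c) => if c == inv_letter a then xi else x
  end.

Section SumsByPrefix.
Variables (R : comPzRingType) (n : nat).
Implicit Types (a b c : letter n) (G : raw n -> R).
Let M : R := 2 * n%:R - 2.

(** Besides [a b b] there are [M] words [a b c], and exactly one of them, with [c = inv_letter a],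
    has weight [xi]. *)
Lemma sum_profile_S2 (x2 x xi : R) a b : a.1 != b.1 ->
  \sum_(w in S2 a b) profile x2 x xi (val w) = M * x + xi.
Proof.
move=> ab; rewrite sum_S2 //=.
have ba : b.1 != (inv_letter a).1 by rewrite eq_sym.
have := sum_neq_const b.1 x.
rewrite (bigD1 (inv_letter a)) //= => eqM.
rewrite (bigD1 (inv_letter a)) //= eqxx.
rewrite (eq_bigr (fun=> x)) => [|c /andP[_ /negPf->] //].
by rewrite -/M in eqM; rewrite -eqM; ring.
Qed.

Lemma sum_profile_S1 (x2 x xi : R) a :
  \sum_(w in S1 a) profile x2 x xi (val w) = x2 + M * (M * x + xi).
Proof.
rewrite sum_S1 /= -(sum_neq_const a.1); congr (_ + _).
apply: eq_bigr => b ab; rewrite -(sum_profile_S2 x2 x xi ab) sum_S2 //.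
Qed.

(** For sum-zero [G] a complement contributes the negated sum, so all relation sums reduce to prefix
    sums. *)
Lemma sum_relset G : \sum_(w : Psi n) G (val w) = 0 -> forall w : raw n,
  \sum_(u in relset w) G (val u) =
  match w with
  | inl (inl a) => - \sum_(u in S1 a) G (val u)
  | inl (inr (a, b)) => - \sum_(u in S2 a b) G (val u)
  | inr (a, b, c) => if c == inv_letter a then \sum_(u in S1 a) G (val u)
                     else - \sum_(u in S2 b c) G (val u)
  end.
Proof.
move=> sum0.
have setC_sum (A : {set Psi n}) :
    \sum_(u in ~: A) G (val u) = - \sum_(u in A) G (val u).
  move: sum0; rewrite (bigID (mem A)) /= => /eqP; rewrite addrC addr_eq0 => /eqP <-.
  by apply: eq_bigl => u; rewrite inE.
by case=> [[a|[a b]]|[[a b] c]] /=; rewrite ?setC_sum //; case: ifP.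
Qed.

(* The stationarity condition at the symmetric point: the Lagrange multipliers
   are [1 - M k] on the words [a a] and [1] elsewhere. *)
Lemma weighted_sum_eq0 (k2 k ki : R) G : \sum_(w : Psi n) G (val w) = 0 ->
  \sum_(w : Psi n) profile (1 - M * k) 1 1 (val w) *
    (G (val w) + profile k2 k ki (val w) * \sum_(u in relset (val w)) G (val u)) = 0.
Proof.
move=> sum0; have relsetE := sum_relset sum0.
pose D1 a := \sum_(u in S1 a) G (val u).
pose D2 a b := \sum_(u in S2 a b) G (val u).
pose T b := \sum_(c | b.1 != c.1) D2 b c.
have sumD1 : \sum_a D1 a = 0 by rewrite -sum_Psi_S1.
have sumT : \sum_a G (w2 a) + \sum_a T a = 0.
  rewrite -[RHS]sum0 sum_Psi_S1 -big_split /=; apply: eq_bigr => a _.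
  rewrite sum_S1; congr (_ + _); apply: eq_bigr => b ab.
  by rewrite /D2 sum_S2.
pose H (w : raw n) := profile (1 - M * k) 1 1 w *
  (G w + profile k2 k ki w * \sum_(u in relset w) G (val u)).
rewrite -/(\sum_(w : Psi n) H (val w)) sum_Psi_S1.
have HE a : \sum_(w in S1 a) H (val w) =
    (1 - M * k) * (G (w2 a) - k2 * D1 a) + ((1 - k) * T a + M * (ki * D1 a)
     - k * \sum_(b | a.1 != b.1) (T b - D2 b (inv_letter a))).
  rewrite sum_S1 {1}/H relsetE /= mulrN; congr (_ + _).
  have -> : M * (ki * D1 a) = \sum_(b : letter n | a.1 != b.1) ki * D1 a.
    by rewrite sum_neq_const.
  rewrite [T a]/T [_ * \sum_(c | _) _]mulr_sumr [X in _ - X]mulr_sumr -sumrN.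
  rewrite -!big_split /=.
  apply: eq_bigr => b ab.
  have ba : b.1 != (inv_letter a).1 by rewrite eq_sym.
  (* The last letter [inv_letter a] is type 4b, with set [S1 a]; every other [c] contributes through
     the complement of [S2 b c]. *)
  have -> : \sum_(c | b.1 != c.1) H (w4 a b c) =
      \sum_(c | b.1 != c.1) G (w4 a b c) + ki * D1 a - k * (T b - D2 b (inv_letter a)).
    have -> : T b - D2 b (inv_letter a) =
        \sum_(c | (b.1 != c.1) && (c != inv_letter a)) D2 b c.
      rewrite /T [X in X - _](bigD1 (inv_letter a)) //=.
      by rewrite addrAC subrr add0r.
    rewrite (bigD1 (inv_letter a)) //= [in RHS](bigD1 (inv_letter a)) //=.
    rewrite {1}/H relsetE /= eqxx mul1r.
    rewrite [X in _ + X = _](eq_bigr (fun c => G (w4 a b c) - k * D2 b c)); last first.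
      by move=> c /andP[_ /negPf ca]; rewrite /H relsetE /= ca mul1r mulrN.
    rewrite sumrB -mulr_sumr -/(D1 a).
    by rewrite addrA [X in X - _]addrAC.
  have -> : \sum_(c | b.1 != c.1) G (w4 a b c) = D2 a b - G (w3 a b).
    by rewrite /D2 sum_S2 // addrAC subrr add0r.
  rewrite /H relsetE /= -/(D2 a b).
  move: (D2 a b) (D1 a) (T b - _) (G _) => x y z u; ring.
under eq_bigr do rewrite HE.
(* Each [T b] occurs for [M] letters [a]; reindexing by [inv_letter] turns the subtracted terms into
   one further [\sum_b T b]. *)
have sum_inv : \sum_a \sum_(b | a.1 != b.1) (T b - D2 b (inv_letter a)) =
    (M - 1) * \sum_b T b.
  rewrite (exchange_big_dep predT) //= mulr_sumr; apply: eq_bigr => b _.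
  rewrite sumrB; under eq_bigl do rewrite eq_sym.
  rewrite sum_neq_const [RHS]mulrBl mul1r; congr (_ - _).
  rewrite (reindex_inj (inv_inj (@inv_letterK n))) /=.
  by apply: eq_big => c; rewrite ?inv_letterK 1?eq_sym.
(* The terms in [k2] and [ki] vanish by [sumD1]. The coefficient of [\sum_a T a] is
   [(1 - k) - k * (M - 1) = 1 - M * k], which dictates the multiplier on the words [a a]: the rest
   cancels by [sumT]. *)
rewrite !big_split /= !sumrN -!mulr_sumr sum_inv !big_split /= !sumrN -!mulr_sumr sumD1.
have -> : \sum_a G (w2 a) = - \sum_a T a by apply/eqP; rewrite -addr_eq0 sumT.
ring.
Qed.

End SumsByPrefix.

(** * Comparison of a minimiser with the symmetric point *)

Lemma level_le (R : realFieldType) (F x X : R) : 0 < x -> 0 < X ->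
  ((1 - x) / x * ((1 - X) / X) <= F) = ((1 - x) * (1 - X) <= F * x * X).
Proof.
move=> x0 X0; have -> : (1 - x) / x * ((1 - X) / X) = (1 - x) * (1 - X) / (x * X).
  by field; rewrite !gt_eqF.
by rewrite ler_pdivrMr ?mulr_gt0 // mulrA.
Qed.

Lemma level_eq (R : realFieldType) (F x X : R) : 0 < x -> 0 < X ->
  (1 - x) * (1 - X) = F * x * X -> (1 - x) / x * ((1 - X) / X) = F.
Proof.
move=> x0 X0 eqF; have -> : (1 - x) / x * ((1 - X) / X) = (1 - x) * (1 - X) / (x * X).
  by field; rewrite !gt_eqF.
by rewrite eqF -mulrA mulfK // mulf_neq0 ?gt_eqF.
Qed.

(** This makes X_r positive on Delta. A squared letter lies in no [S2 a b] with distinct indices, so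
    [a a] serves for every type except 1a, where the inverse square does. *)
Lemma relset_neq0 n (w : Psi n) : exists u, u \in relset (val w).
Proof.
pose dbl a : Psi n := exist _ (w2 a) isT.
have dblS2 (a b c : letter n) : a.1 != b.1 -> dbl c \in ~: S2 a b.
  move=> ab; rewrite !inE /= !eqseq_cons andbT.
  by apply/negP => /andP[/eqP-> /eqP cb]; rewrite cb eqxx in ab.
case: w => [[[a|[a b]]|[[a b] c]] /= vw].
- exists (dbl (inv_letter a)); rewrite !inE /= eqseq_cons andbT.
  by case: a {vw} => i [] /=; rewrite xpair_eqE andbF.
- by exists (dbl a); rewrite dblS2.
have /andP[ab bc] : (a.1 != b.1) && (b.1 != c.1) := vw.
by exists (dbl a); case: ifP => _; rewrite ?dblS2 // inE.
Qed.

(** This makes the multiplier [1 - M * k] positive. From [s <= 1/8] follows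
    [F * q <= s / (1 - s) <= 1/7], so the numerator of the slope is at most [8/7], while
    [F >= 2 * M] makes its denominator exceed [7 * M / 4]. *)
Lemma slope_bound (R : realFieldType) (M F q s : R) :
  2 <= M -> 2 * M <= F -> 0 < q -> 0 < s -> s <= 8^-1 ->
  (1 - q) * s = F * q * (1 - s) -> M * slope F q (1 - s) < 1.
Proof.
move=> M_ge2 F_ge q_gt0 s_gt0 s_le eqq.
have Fq_le : F * q <= 7^-1 by nra.
rewrite /slope mulrA ltr_pdivrMr ?mul1r; last by nra.
have : M * (1 + (F - 1) * q) <= M * (8 / 7) by rewrite ler_pM2l; lra.
by nra.
Qed.

Theorem theorem5p9 (R : realType) (n : nat) (hn : (2 <= n)%N)
  (xs : Psi n -> R) (hxs : inDelta xs)
  (hmin : forall y : Psi n -> R, inDelta y -> Fmax xs <= Fmax y) :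
  forall r1 r2 : relation n, r1 \in relF n -> r2 \in relF n ->
    f_r r1 xs = f_r r2 xs.
Proof.
have [xs_gt0 xs_sum] := hxs.
pose N : R := 2 * n%:R; pose M : R := N - 2.
have N_ge4 : 4 <= N by rewrite /N -natrM ler_nat (leq_mul2l 2 2).
have [F [p [q [v [s [F_ge [p_gt0 q_gt0 v_gt0 /andP[s_gt0 s_le]] s_def sum1 [eqp eqq eqv]]]]]]] :=
  symmetric_solution N_ge4 (erefl M).
have F_gt1 : 1 < F by rewrite /M in F_ge; lra.
have N_gt0 : 0 < N by lra.
have sum_a : p + M * s = N^-1.
  by apply: (mulfI (lt0r_neq0 N_gt0)); rewrite sum1 divff ?lt0r_neq0.
have Ninv_gt0 : 0 < N^-1 by rewrite invr_gt0.
have Ninv_lt1 : N^-1 < 1 by rewrite invf_lt1 //; lra.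
pose x0 (w : raw n) : R := profile p q v w.
pose X0 (w : raw n) : R := profile (1 - N^-1) (1 - s) N^-1 w.
have x0_gt0 w : 0 < x0 w by case: w => [[a|[a b]]|[[a b] c]] //=; case: ifP.
have X0_gt0 w : 0 < X0 w.
  by case: w => [[a|[a b]]|[[a b] c]] /=; [rewrite subr_gt0|rewrite subr_gt0; lra|case: ifP => _ //; rewrite subr_gt0; lra].
have level0 w : (1 - x0 w) * (1 - X0 w) = F * x0 w * X0 w.
  by case: w => [[a|[a b]]|[[a b] c]] /=; [|
    |case: ifP => _ //]; rewrite opprB addrCA subrr addr0.
have sumS1_x0 a : \sum_(u in S1 a) x0 (val u) = N^-1.
  by rewrite sum_profile_S1 -/N -/M -s_def.
have sumS2_x0 a b : a.1 != b.1 -> \sum_(u in S2 a b) x0 (val u) = s.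
  by move=> ab; rewrite sum_profile_S2 // -/N -/M -s_def.
have sum_x0 : \sum_(u : Psi n) x0 (val u) = 1.
  rewrite sum_Psi_S1; under eq_bigr do rewrite sumS1_x0.
  rewrite sumr_const card_prod card_ord card_bool -mulr_natl mulnC natrM -/N.
  by rewrite divff ?lt0r_neq0.
have X0E (w : Psi n) : \sum_(u in relset (val w)) x0 (val u) = X0 (val w).
  have setC_sum (A : {set Psi n}) :
      \sum_(u in ~: A) x0 (val u) = 1 - \sum_(u in A) x0 (val u).
    rewrite -sum_x0 (bigID (mem A) predT) /= addrAC subrr add0r.
    by apply: eq_bigl => u; rewrite inE.
  case: w => [[[a|[a b]]|[[a b] c]] /= vw].
  - by rewrite setC_sum sumS1_x0.
  - by rewrite setC_sum sumS2_x0.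
  have /andP[ab bc] : (a.1 != b.1) && (b.1 != c.1) := vw.
  by rewrite /X0 /=; case: ifP => _; rewrite ?sumS1_x0 ?setC_sum ?sumS2_x0.
pose y0 (w : Psi n) : R := x0 (val w).
have y0_Delta : inDelta y0 by split=> // w; exact: x0_gt0.
have f_y0 r : r \in relF n -> f_r r y0 = F.
  move=> rF; rewrite /f_r /xr /Xr (relF_relset rF) X0E.
  exact: (level_eq (x0_gt0 _) (X0_gt0 _) (level0 _)).
have Fmax_y0 : Fmax y0 <= F.
  by apply: bigmax_le => [|r rF]; [lra | rewrite f_y0].
have Xs_gt0 (w : Psi n) : 0 < \sum_(u in relset (val w)) xs u.
  have [u uw] := relset_neq0 w.
  rewrite (bigD1 u) //= ltr_pwDl //; apply: sumr_ge0 => i _; exact: ltW.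
have level_xs (w : Psi n) :
    (1 - xs w) * (1 - \sum_(u in relset (val w)) xs u) <=
    F * xs w * \sum_(u in relset (val w)) xs u.
  rewrite -level_le //; apply: le_trans Fmax_y0; apply: le_trans (hmin y0 y0_Delta).
  exact: (le_bigmax_cond _ (fun r => f_r r xs) (relset_relF w)).
pose k (w : raw n) := slope F (x0 w) (X0 w).
pose kq := slope F q (1 - s).
(* The difference [xs - x0] extended to raw words; the default 0 for [xs] is met only at invalid
   words. *)
pose G (w : raw n) : R := oapp xs 0 (insub w) - x0 w.
have GE (w : Psi n) : G (val w) = xs w - x0 (val w) by rewrite /G valK.
have kE w : k w = profile (slope F p (1 - N^-1)) kq (slope F v N^-1) w.
  by case: w => [[a|[a b]]|[[a b] c]] //=; rewrite /k /x0 /X0 /=; case: ifP.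
have lam_gt0 (w : raw n) : 0 < profile (1 - M * kq) 1 1 w.
  have lt1 : M * kq < 1 by apply: slope_bound => //; rewrite /M; lra.
  by case: w => [[a|[a b]]|[[a b] c]] //=; [rewrite subr_gt0 | case: ifP].
have sumG : \sum_(w : Psi n) G (val w) = 0.
  by under eq_bigr do rewrite GE; rewrite sumrB xs_sum sum_x0 subrr.
have tangent (w : Psi n) := tangent_level F_gt1 (xs_gt0 w) (Xs_gt0 w)
  (x0_gt0 (val w)) (X0_gt0 (val w)) (level0 (val w)) (level_xs w).
have termE (w : Psi n) :
    G (val w) + profile (slope F p (1 - N^-1)) kq (slope F v N^-1) (val w) *
      \sum_(u in relset (val w)) G (val u) =
    (xs w - x0 (val w)) + slope F (x0 (val w)) (X0 (val w)) *
      (\sum_(u in relset (val w)) xs u - X0 (val w)).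
  rewrite -kE GE; congr (_ + _ * _); rewrite -X0E -sumrB.
  by apply: eq_bigr => u _; rewrite GE.
have xs_eq w : xs w = y0 w.
  apply: (proj2 (tangent w)).
  apply: (mulfI (lt0r_neq0 (lam_gt0 (val w)))).
  rewrite mulr0 -termE.
  have := weighted_sum_eq0 (slope F p (1 - N^-1)) kq (slope F v N^-1) sumG.
  rewrite -/N -/M => /psumr_eq0P; apply=> // u _.
  rewrite termE; apply: mulr_ge0; [exact: ltW | exact: (proj1 (tangent u))].
have f_xs r : r \in relF n -> f_r r xs = F.
  move=> rF; rewrite -(f_y0 r rF) /f_r /xr /Xr xs_eq.
  by under eq_bigr do rewrite xs_eq.
by move=> r1 r2 r1F r2F; rewrite !f_xs.
Qed.
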